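(* There exist two graphs $G$ and $H$ such that $A(G)-\mu D(G)$ and $A(H)-\mu D(H)$ are similar over $\mathbb{Q}(\mu)$, but $G$ and $H$ are not degree-similar.
   Context: Graphs are finite and simple. For a graph $G$, $A(G)$ is its adjacency matrix and $D(G)$ its degree matrix (the diagonal matrix of vertex degrees, with the same ordering of the vertices as $A(G)$). $\mathbb{Q}(\mu)$ denotes the field of rational functions in one indeterminate $\mu$ over $\mathbb{Q}$, and $A(G)-\mu D(G)$ is viewed as a matrix over $\mathbb{Q}(\mu)$. Two square matrices $K,L$ of the same size over a field $\mathbb{F}$ are similar over $\mathbb{F}$ if $P^{-1}KP=L$ for some invertible matrix $P$ over $\mathbb{F}$. Two graphs $G$ and $H$ are degree-similar if there exists an invertible real matrix $M$ such that $M^{-1}A(G)M=A(H)$ and $M^{-1}D(G)M=D(H)$. *)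

(* Defs.v *)
From mathcomp Require Import all_boot all_order all_algebra.
From mathcomp Require Import reals Rstruct.

Set Implicit Arguments.
Unset Strict Implicit.
Unset Printing Implicit Defensive.

Import GRing.Theory.
Local Open Scope ring_scope.

(* The matrices of a graph presuppose an ordering of its vertices, so the
   vertex set of a graph with n vertices is taken to be 'I_n. *)
Record sgraph (n : nat) := SGraph {
  adj :> rel 'I_n;
  adj_sym : symmetric adj;
  adj_irr : irreflexive adj }.

Definition degree n (G : sgraph n) (i : 'I_n) : nat := #|[set j | G i j]|.

Definition adjmx (F : fieldType) n (G : sgraph n) : 'M[F]_n :=
  \matrix_(i, j) (G i j)%:R.

Definition degmx (F : fieldType) n (G : sgraph n) : 'M[F]_n :=
  diag_mx (\row_i (degree G i)%:R).

Definition similar_over (F : fieldType) n (K L : 'M[F]_n) : Prop :=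
  exists2 P : 'M[F]_n, P \in unitmx & invmx P *m K *m P = L.

Definition degree_similar n (G H : sgraph n) : Prop :=
  exists2 M : 'M[Rdefinitions.R]_n, M \in unitmx &
    invmx M *m adjmx _ G *m M = adjmx _ H /\
    invmx M *m degmx _ G *m M = degmx _ H.

Definition ratfun : fieldType := {fraction {poly rat}}.

Definition mu : ratfun := @FracField.tofrac {poly rat} 'X.

(* Main.v *)
Require Import Defs.
From mathcomp Require Import all_boot all_order all_algebra.
From mathcomp Require Import Rstruct.

Set Implicit Arguments.
Unset Strict Implicit.

Import GRing.Theory.
Local Open Scope ring_scope.

(** The two graphs are trees on 11 vertices.  Solutions P of the intertwining
    equation (A(G) - mu D(G)) P = P (A(H) - mu D(H)) that are affine in mu,
    P = P0 + mu P1, are given by three identities between rational matrices, one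
    for each power of mu; there is an integral solution which is invertible over
    Q(mu) because its value at mu = 1 is invertible.  On the other hand, a
    simultaneous similarity of (A, D) preserves the trace of every word in A and
    D, and the word A A D A D A D has trace 1154 for G and 1150 for H. *)

(** * Integer matrices as lists of rows, for evaluation *)

Section SeqMatrix.

Variable n : nat.
Implicit Types (s t : seq (seq int)) (f : nat -> nat -> int).

Definition entry s i j : int := nth 0 (nth [::] s i) j.

Definition tabulate f : seq (seq int) := mkseq (fun i => mkseq (f i) n) n.

Definition mxseq s : 'M[int]_n := \matrix_(i, j) entry s i j.

(** The [foldr] to which [\sum] unlocks; unlike the locked operator, it evaluates. *)
Definition sum_upto (g : nat -> int) : int :=
  foldr (fun k => +%R (g k)) 0 (iota 0 n).

Definition seq_mul s t :=
  tabulate (fun i j => sum_upto (fun k => entry s i k * entry t k j)).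
Definition seq_sub s t := tabulate (fun i j => entry s i j - entry t i j).
Definition seq_add s t := tabulate (fun i j => entry s i j + entry t i j).
Definition seq_scalar (a : int) := tabulate (fun i j => if i == j then a else 0).
Definition seq_trace s := sum_upto (fun i => entry s i i).

Lemma sum_uptoE g : sum_upto g = \sum_(i < n) g i.
Proof. by rewrite -(big_mkord xpredT) /index_iota subn0 unlock. Qed.

Lemma mxseq_tabulate f : mxseq (tabulate f) = \matrix_(i, j) f i j.
Proof. by apply/matrixP => i j; rewrite !mxE /entry !nth_mkseq. Qed.

Lemma mxseqM s t : mxseq s *m mxseq t = mxseq (seq_mul s t).
Proof.
rewrite mxseq_tabulate; apply/matrixP => i j; rewrite !mxE sum_uptoE.
by apply: eq_bigr => k _; rewrite !mxE.
Qed.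

Lemma mxseqB s t : mxseq s - mxseq t = mxseq (seq_sub s t).
Proof. by rewrite mxseq_tabulate; apply/matrixP => i j; rewrite !mxE. Qed.

Lemma mxseqD s t : mxseq s + mxseq t = mxseq (seq_add s t).
Proof. by rewrite mxseq_tabulate; apply/matrixP => i j; rewrite !mxE. Qed.

Lemma mxseq_scalar a : a%:M = mxseq (seq_scalar a).
Proof.
rewrite mxseq_tabulate; apply/matrixP => i j; rewrite !mxE.
by rewrite -val_eqE; case: eqP.
Qed.

Lemma mxtrace_mxseq s : \tr (mxseq s) = seq_trace s.
Proof.
by rewrite /seq_trace sum_uptoE; apply: eq_bigr => i _; rewrite mxE.
Qed.

End SeqMatrix.

(** * Similarity over Q(mu), and an invariant of degree-similarity *)

Lemma similar_over_intertwine (F : fieldType) n (K L P : 'M[F]_n) :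
  P \in unitmx -> K *m P = P *m L -> similar_over K L.
Proof. by move=> uP KP; exists P; rewrite // -mulmxA KP mulKmx. Qed.

Lemma conj_mulmx (F : fieldType) n (M X Y : 'M[F]_n) :
  M \in unitmx ->
  (invmx M *m X *m M) *m (invmx M *m Y *m M) = invmx M *m (X *m Y) *m M.
Proof. by move=> uM; rewrite !mulmxA mulmxK. Qed.

Lemma mxtrace_conj (F : fieldType) n (M X : 'M[F]_n) :
  M \in unitmx -> \tr (invmx M *m X *m M) = \tr X.
Proof. by move=> uM; rewrite mxtrace_mulC mulmxA mulmxV ?mul1mx. Qed.

(** For the matrices of a graph, the trace sums, over closed walks v0 v1 v2 v3 v0, the product of
    the degrees of v0, v2 and v3. *)
Definition word7 (R : pzSemiRingType) n (A D : 'M[R]_n) : 'M[R]_n :=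
  A *m A *m D *m A *m D *m A *m D.

Lemma degree_similar_word7 n (G H : sgraph n) :
  degree_similar G H ->
  \tr (word7 (adjmx _ G) (degmx _ G)) =
  \tr (word7 (adjmx _ H) (degmx _ H)) :> Rdefinitions.R.
Proof.
case=> M uM [<- <-]; rewrite /word7 !conj_mulmx //.
by rewrite mxtrace_conj.
Qed.

Definition affine_mx n (P0 P1 : 'M[int]_n) : 'M[ratfun]_n :=
  map_mx intr P0 + mu *: map_mx intr P1.

(** The determinant is a polynomial in [mu]. Its value at 1 is nonzero, since multiplying it by
    [\det Q] gives [c ^+ n]. The factor [c] clears denominators, so the certificate [Q] is
    integral. *)
Lemma affine_mx_unit n (P0 P1 Q : 'M[int]_n) (c : int) :
  c != 0 -> (P0 + P1) *m Q = c%:M -> affine_mx P0 P1 \in unitmx.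
Proof.
move=> c0 PQ.
pose P : 'M[{poly rat}]_n := map_mx intr P0 + 'X *: map_mx intr P1.
(* Evaluation at 1 is defined on polynomials but not on all of Q(mu), hence the lift. *)
have -> : affine_mx P0 P1 = map_mx (@FracField.tofrac {poly rat}) P.
  by rewrite map_mxD map_mxZ -!map_mx_comp; congr (_ + _ *: _);
     apply/matrixP => i j; rewrite !mxE /= rmorph_int.
rewrite unitmxE det_map_mx unitfE tofrac_eq0.
apply/eqP => dP; have : \det (map_mx (horner_eval (1 : rat)) P) = 0.
  by rewrite det_map_mx dP rmorph0.
have -> : map_mx (horner_eval (1 : rat)) P = map_mx intr (P0 + P1).
  apply/matrixP => i j; rewrite !mxE rmorphD rmorphM /= !rmorph_int.
  by rewrite rmorphD /= /horner_eval hornerX mul1r.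
rewrite det_map_mx => /eqP; rewrite intr_eq0 => /eqP dP0.
have := congr1 (fun X => \det X) PQ; rewrite /= det_mulmx dP0 mul0r det_scalar.
by move/esym/eqP; rewrite expf_eq0 (negPf c0) andbF.
Qed.

(** The last three hypotheses compare the coefficients of 1, [mu] and, up to sign, [mu ^+ 2] in the
    intertwining equation. *)
Lemma similar_over_affine n (A D B E P0 P1 Q : 'M[int]_n) (c : int) :
    c != 0 -> (P0 + P1) *m Q = c%:M ->
    A *m P0 = P0 *m B -> A *m P1 - D *m P0 = P1 *m B - P0 *m E ->
    D *m P1 = P1 *m E ->
  similar_over (map_mx intr A - mu *: map_mx intr D)
               (map_mx intr B - mu *: map_mx intr E).
Proof.
move=> c0 PQ e0 e1 e2.
apply: (@similar_over_intertwine _ _ _ _ (affine_mx P0 P1)).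
  exact: affine_mx_unit c0 PQ.
have mxM X Y : map_mx intr X *m map_mx intr Y = map_mx intr (X *m Y) :> 'M[ratfun]_n.
  by rewrite map_mxM.
rewrite /affine_mx !(mulmxDl, mulmxDr, mulNmx, mulmxN) -!(scalemxAl, scalemxAr).
(* The constant terms are stripped from the front and the quadratic ones from the back; the linear
   terms remain for [e1]. *)
rewrite !mxM e0 e2 -!addrA; congr (_ + _); rewrite !addrA; congr (_ + _).
by rewrite [RHS]addrC -!scalerBr -!map_mxB e1.
Qed.

(** * Trees given by parent lists, and their matrices *)

Section ParentTree.

Variable n : nat.
Implicit Types p : seq nat.

(* [p_i] is the parent of [i]; the root is its own parent. *)
Definition tree_edge p i j := (i != j) && ((nth 0 p i == j) || (nth 0 p j == i))%N.

Definition tree_rel p : rel 'I_n := fun i j => tree_edge p i j.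

Lemma tree_rel_sym p : symmetric (tree_rel p).
Proof. by move=> i j; rewrite /tree_rel /tree_edge eq_sym orbC. Qed.

Lemma tree_rel_irr p : irreflexive (tree_rel p).
Proof. by move=> i; rewrite /tree_rel /tree_edge eqxx. Qed.

Definition tree p : sgraph n := SGraph (tree_rel_sym p) (tree_rel_irr p).

Definition tree_adj p := tabulate n (fun i j => (tree_edge p i j)%:R).

Definition tree_deg p :=
  tabulate n (fun i j => if i == j then sum_upto n (fun k => (tree_edge p i k)%:R) else 0).

(** One integer table serves every field, hence both Q(mu) and the reals. *)
Lemma adjmx_tree (F : fieldType) p :
  adjmx F (tree p) = map_mx intr (mxseq n (tree_adj p)).
Proof.
rewrite mxseq_tabulate; apply/matrixP => i j; rewrite !mxE /= /tree_rel.
by case: (tree_edge p i j).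
Qed.

Lemma degmx_tree (F : fieldType) p :
  degmx F (tree p) = map_mx intr (mxseq n (tree_deg p)).
Proof.
rewrite mxseq_tabulate; apply/matrixP => i j; rewrite !mxE -val_eqE /=.
case: eqP => // _; rewrite mulr1n sum_uptoE -natr_sum rmorph_nat; congr _%:R.
rewrite /degree -sum1_card big_mkcond; apply: eq_bigr => k _.
by rewrite inE /= /tree_rel; case: tree_edge.
Qed.

End ParentTree.

(** * The two trees and their certificates *)

Definition parentsG : seq nat := [:: 0; 0; 1; 2; 2; 0; 5; 6; 5; 5; 0]%N.
Definition parentsH : seq nat := [:: 0; 0; 1; 2; 2; 1; 1; 0; 7; 8; 7]%N.

(** Both are caterpillars: the non-leaves form a path, with tree degrees 3, 2, 3, 4, 2 in [treeG]
    and 3, 4, 2, 3, 2 in [treeH]. *)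
Definition treeG : sgraph 11 := tree 11 parentsG.
Definition treeH : sgraph 11 := tree 11 parentsH.

(* [P0 + mu P1] was found by linear algebra; [Q0] is [6 (P0 + P1)^-1]. *)
Definition P0 : seq (seq int) :=
  [:: [:: 0; 2; 0; 0; 0; 0; 0; 1; 0; 0; 0];
      [:: 2; 0; 0; 0; 0; 0; 0; 0; 1; 0; 0];
      [:: 0; 0; 0; 0; 0; 0; 0; 2; 0; 1; 0];
      [:: 0; 0; 0; 0; 0; 0; 0; 0; 1; 0; 1];
      [:: 0; 0; 0; 0; 0; 0; 0; 0; 1; 0; 1];
      [:: 1; 0; 2; 0; 0; 1; 1; 0; 0; 0; 0];
      [:: 0; 1; 0; 1; 1; 0; 0; 0; 0; 0; 0];
      [:: 0; 0; 1; 0; 0; 0; 0; 0; 0; 0; 0];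
      [:: 0; 1; 0; 0; 1; 0; 0; 0; 0; 0; 0];
      [:: 0; 1; 0; 1; 0; 0; 0; 0; 0; 0; 0];
      [:: 0; 0; 0; 0; 0; 1; 1; 0; 0; 0; 1]].

Definition P1 : seq (seq int) :=
  [:: [:: 0; 0; 0; 0; 0; 0; 0; 0; 0; 0; 0];
      [:: 0; 0; 0; 0; 0; 0; 0; 0; 0; 0; 0];
      [:: 0; 0; 0; 0; 0; 0; 0; 0; 0; 0; 0];
      [:: 0; 0; 0; 1; -1; 0; 0; 0; 0; 1; 0];
      [:: 0; 0; 0; -1; 1; 0; 0; 0; 0; 1; 0];
      [:: 0; -2; 0; 0; 0; 0; 0; 0; 0; 0; 0];
      [:: 0; 0; 0; 0; 0; 0; 0; 0; 0; 0; 0];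
      [:: 0; 0; 0; 1; 1; 0; 0; 0; 0; 0; 0];
      [:: 0; 0; 0; 0; 0; 1; 0; 0; 0; 0; 0];
      [:: 0; 0; 0; 0; 0; 0; 1; 0; 0; 0; 0];
      [:: 0; 0; 0; 0; 0; 0; 0; 0; 0; 0; 0]].

Definition Q0 : seq (seq int) :=
  [:: [:: 4; -2; -2; 1; 1; 10; 28; -20; -8; -8; -2];
      [:: 4; -2; -2; 1; 1; 4; 10; -8; -2; -2; -2];
      [:: 4; -2; -2; 1; 1; 4; 4; -2; -2; -2; -2];
      [:: -2; 1; 1; 1; -2; -2; -2; 4; 1; 1; 1];
      [:: -2; 1; 1; -2; 1; -2; -2; 4; 1; 1; 1];
      [:: -2; 1; 1; 1; -2; -2; -8; 4; 7; 1; 1];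
      [:: -2; 1; 1; -2; 1; -2; -8; 4; 1; 7; 1];
      [:: -2; 4; 4; -2; -2; -8; -20; 16; 4; 4; 4];
      [:: -8; 10; 4; -2; -2; -20; -56; 40; 16; 16; 4];
      [:: 4; -8; -2; 4; 4; 16; 40; -32; -8; -8; -8];
      [:: 4; -2; -2; 1; 1; 4; 16; -8; -8; -8; 4]].

Lemma similar_trees :
  similar_over (adjmx ratfun treeG - mu *: degmx ratfun treeG)
               (adjmx ratfun treeH - mu *: degmx ratfun treeH).
Proof.
rewrite !adjmx_tree !degmx_tree.
apply: (@similar_over_affine _ _ _ _ _ (mxseq 11 P0) (mxseq 11 P1) (mxseq 11 Q0) 6).
- by [].
- by rewrite mxseqD mxseqM mxseq_scalar; congr (mxseq _ _); vm_compute.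
- by rewrite !mxseqM; congr (mxseq _ _); vm_compute.
- by rewrite !mxseqM !mxseqB; congr (mxseq _ _); vm_compute.
- by rewrite !mxseqM; congr (mxseq _ _); vm_compute.
Qed.

(** The [foldl] mirrors the left association of the product in [word7]. *)
Lemma trace_word7_tree (F : fieldType) n p (A := tree_adj n p) (D := tree_deg n p) :
  \tr (word7 (adjmx F (tree n p)) (degmx F (tree n p))) =
  (seq_trace n (foldl (seq_mul n) A [:: A; D; A; D; A; D]))%:~R.
Proof.
rewrite adjmx_tree degmx_tree /word7 -!map_mxM trace_map_mx !mxseqM.
by rewrite mxtrace_mxseq.
Qed.

Lemma not_degree_similar_trees : ~ degree_similar treeG treeH.
Proof.
move/degree_similar_word7; rewrite !trace_word7_tree => /eqP.
(* Integers embed in the reals, so it remains to evaluate 1154 and 1150. *)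
by rewrite eqr_int; vm_compute.
Qed.

Theorem mainTheorem2 :
  exists (n : nat) (G H : sgraph n),
    similar_over (adjmx ratfun G - mu *: degmx ratfun G)
                 (adjmx ratfun H - mu *: degmx ratfun H)
    /\ ~ degree_similar G H.
Proof.
exists 11%N, treeG, treeH; split.
  exact: similar_trees.
exact: not_degree_similar_trees.
Qed.
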